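(* Let $n\ge2$, $d$ and $k$ be integers and let $\alpha\in\mathbb{R}$. Suppose $0<k<n$ and $G(\alpha;n,d,k)$ is non-empty, and let the integers $a,t,l,m$ be defined by $$d=na-t,\quad 0\le t<n,\qquad ka-t=l(n-k)+m,\quad 0\le m<n-k.$$ Then $$\alpha<\frac{d}{n-k}-\frac{mn}{k(n-k)}.$$ Moreover, let $(E,V)$ be a coherent system of type $(n,d,k)$ fitting into an exact sequence $$0\to\mathcal{O}^k\to E\to G\to 0$$ with $V=H^0(\mathcal{O}^k)\subset H^0(E)$, $E\simeq\mathcal{O}(a)^{n-t}\oplus\mathcal{O}(a-1)^t$ and $G\simeq\mathcal{O}(a+l+1)^m\oplus\mathcal{O}(a+l)^{n-k-m}$. If $\alpha<\frac{d}{n-k}-\frac{mn}{k(n-k)}$ holds, then every proper coherent subsystem $(E',V')$ of $(E,V)$ of type $(r,d',k)$ satisfies the $\alpha$-stability condition $\mu_\alpha(E',V')<\mu_\alpha(E,V)$.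
   Context: Work on the projective line $\mathbb{P}^1$ over an algebraically closed field. A coherent system of type $(n,d,k)$ is a pair $(E,V)$ where $E$ is a vector bundle of rank $n$ and degree $d$ on $\mathbb{P}^1$ and $V\subset H^0(E)$ is a vector subspace of dimension $k$. For $\alpha\in\mathbb{R}$ its $\alpha$-slope is $\mu_\alpha(E,V)=\frac{d}{n}+\alpha\frac{k}{n}$. A coherent subsystem of $(E,V)$ is a coherent system $(E',V')$ with $E'$ a (nonzero) subbundle of $E$ and $V'\subset V\cap H^0(E')$; it is proper if $(E',V')\neq(E,V)$. $(E,V)$ is $\alpha$-stable if $\mu_\alpha(E',V')<\mu_\alpha(E,V)$ for every proper coherent subsystem $(E',V')$. $G(\alpha;n,d,k)$ denotes the moduli space of $\alpha$-stable coherent systems of type $(n,d,k)$ on $\mathbb{P}^1$. *)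

(* Defs.v *)
From HB Require Import structures.
From mathcomp Require Import all_boot all_order all_algebra.
From mathcomp Require Import boolp classical_sets reals.

Set Implicit Arguments.
Unset Strict Implicit.
Unset Printing Implicit Defensive.
Import Order.TTheory GRing.Theory Num.Theory.
Local Open Scope ring_scope.
Local Open Scope classical_set_scope.

(* P^1 over F is covered by the charts Spec F[z] and Spec F[w], glued along
   w = 1/z.  Functions on either chart, and on the overlap Spec F[z, 1/z], are
   viewed inside the function field F(z). *)

Definition funfield (F : fieldType) := {fraction {poly F}}.

Definition zvar (F : fieldType) : funfield F := tofrac ('X : {poly F}).

Definition zconst (F : fieldType) (c : F) : funfield F := tofrac c%:P.

Definition in_z (F : fieldType) (p : {poly F}) : funfield F := tofrac p.

(* p |-> p(1/z) *)
Definition in_w (F : fieldType) (p : {poly F}) : funfield F :=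
  (map_poly (@zconst F) p).[(zvar F)^-1].

Definition laurent (F : fieldType) (x : funfield F) : Prop :=
  exists (p : {poly F}) (N : nat), x = in_z p / zvar F ^+ N.

(* A vector bundle of rank n.  As F[z] and F[w] are principal ideal domains,
   its restrictions to the two charts are trivial, and the bundle is given by
   a transition matrix in GL_n(F[z, 1/z]).  Sections are row vectors: s0 over
   F[z] and s1 over F[w] glue when s0(z) *m g = s1(1/z). *)
Record vbundle (F : fieldType) (n : nat) := VBundle {
  trans :> 'M[funfield F]_n;
  transP : (forall i j, laurent (trans i j)) /\
           exists h : 'M[funfield F]_n,
             (forall i j, laurent (h i j)) /\ trans *m h = 1%:M }.

(* The transition function of O(a) is z^(-a), so that H^0(O(a)) consists of
   the polynomials of degree at most a. *)
Definition has_degree (F : fieldType) (n : nat) (E : vbundle F n) (d : int) :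
    Prop :=
  exists2 c : F, c != 0 & \det E = zconst c * zvar F ^ (- d).

(* A global section is determined by its restriction to the z-chart. *)
Definition H0 (F : fieldType) (n : nat) (E : vbundle F n) :
    set 'rV[{poly F}]_n :=
  [set s0 | exists s1 : 'rV[{poly F}]_n,
     map_mx (@in_z F) s0 *m E = map_mx (@in_w F) s1].

Record vbhom (F : fieldType) (n n' : nat)
    (E : vbundle F n) (E' : vbundle F n') := VBHom {
  hom_z : 'M[{poly F}]_(n, n');
  hom_w : 'M[{poly F}]_(n, n');
  homP : map_mx (@in_z F) hom_z *m E' = E *m map_mx (@in_w F) hom_w }.

Definition vbiso (F : fieldType) (n n' : nat) (E : vbundle F n)
    (E' : vbundle F n') (f : vbhom E E') : Prop :=
  exists g : vbhom E' E,
    [/\ hom_z f *m hom_z g = 1%:M, hom_z g *m hom_z f = 1%:M,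
        hom_w f *m hom_w g = 1%:M & hom_w g *m hom_w f = 1%:M].

Definition vbisomorphic (F : fieldType) (n n' : nat) (E : vbundle F n)
    (E' : vbundle F n') : Prop :=
  exists f : vbhom E E', vbiso f.

(* f embeds E as a subbundle of E': it is injective on the fibre at every
   F-point of each chart.  For F algebraically closed these are all the closed
   points of P^1, the point at infinity being the origin of the w-chart. *)
Definition subbundle_emb (F : fieldType) (n n' : nat) (E : vbundle F n)
    (E' : vbundle F n') (f : vbhom E E') : Prop :=
  forall x : F, row_free (map_mx (horner_eval x) (hom_z f)) /\
                row_free (map_mx (horner_eval x) (hom_w f)).

(* 0 -> A^p -> A^n -> A^q -> 0 is exact, matrices acting on row vectors. *)
Definition short_exact_mx (A : pzRingType) (p n q : nat)
    (f : 'M[A]_(p, n)) (g : 'M[A]_(n, q)) : Prop :=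
  [/\ forall u : 'rV[A]_p, u *m f = 0 -> u = 0,
      forall v : 'rV[A]_n, v *m g = 0 <-> exists u : 'rV[A]_p, v = u *m f
    & forall y : 'rV[A]_q, exists v : 'rV[A]_n, y = v *m g].

Definition short_exact (F : fieldType) (p n q : nat) (E' : vbundle F p)
    (E : vbundle F n) (E'' : vbundle F q)
    (f : vbhom E' E) (g : vbhom E E'') : Prop :=
  short_exact_mx (hom_z f) (hom_z g) /\ short_exact_mx (hom_w f) (hom_w g).

Definition Osum_trans (F : fieldType) (n : nat) (a : 'I_n -> int) :
    'M[funfield F]_n :=
  diag_mx (\row_i zvar F ^ (- a i)).

Lemma zvar_neq0 (F : fieldType) : zvar F != 0.
Proof. by rewrite /zvar tofrac_eq0 polyX_eq0. Qed.

Lemma laurent_zexp (F : fieldType) (e : int) : laurent (zvar F ^ e).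
Proof.
case: e => k.
  by exists ('X^k), 0%N; rewrite expr0 divr1 /in_z /zvar tofracXn.
by exists 1, k.+1; rewrite /in_z tofrac1 mul1r NegzE exprnN.
Qed.

Lemma laurent0 (F : fieldType) : laurent (0 : funfield F).
Proof. by exists 0, 0%N; rewrite /in_z tofrac0 mul0r. Qed.

Lemma laurent_Osum (F : fieldType) (n : nat) (a : 'I_n -> int) i j :
  laurent (Osum_trans F a i j).
Proof.
rewrite /Osum_trans !mxE; case: (i == j); rewrite ?mulr1n ?mulr0n.
  exact: laurent_zexp.
exact: laurent0.
Qed.

Lemma Osum_transP (F : fieldType) (n : nat) (a : 'I_n -> int) :
  (forall i j, laurent (Osum_trans F a i j)) /\
  exists h : 'M[funfield F]_n,
    (forall i j, laurent (h i j)) /\ Osum_trans F a *m h = 1%:M.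
Proof.
split; first exact: laurent_Osum.
exists (Osum_trans F (fun i => - a i)); split; first exact: laurent_Osum.
rewrite /Osum_trans mulmx_diag; apply/matrixP => i j; rewrite !mxE.
by rewrite -expfzDr ?zvar_neq0// subrr expr0z.
Qed.

(* O(a_0) (+) ... (+) O(a_(n-1)) *)
Definition Osum (F : fieldType) (n : nat) (a : 'I_n -> int) : vbundle F n :=
  VBundle (Osum_transP F a).

Definition Otriv (F : fieldType) (k : nat) : vbundle F k :=
  Osum F (fun _ : 'I_k => 0).

(* O(a)^p (+) O(b)^(n-p) *)
Definition Osum2 (F : fieldType) (n p : nat) (a b : int) : vbundle F n :=
  Osum F (fun i : 'I_n => if (i < p)%N then a else b).

Record cohsys (F : fieldType) (n : nat) := CohSys {
  vb :> vbundle F n;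
  secs : set 'rV[{poly F}]_n;
  secs_H0 : secs `<=` H0 vb;
  secs_subspace : secs 0 /\
    forall (c : F) u v, secs u -> secs v -> secs (c%:P *: u + v) }.

(* The rows of B form an F-basis of V. *)
Definition has_dim (F : fieldType) (n : nat) (V : set 'rV[{poly F}]_n)
    (k : nat) : Prop :=
  exists B : 'M[{poly F}]_(k, n),
    injective (fun c : 'rV[F]_k => map_mx polyC c *m B) /\
    V = range (fun c : 'rV[F]_k => map_mx polyC c *m B).

Definition has_type (F : fieldType) (n : nat) (S : cohsys F n) (d : int)
    (k : nat) : Prop :=
  has_degree S d /\ has_dim (secs S) k.

Definition slope (R : realType) (alpha : R) (n : nat) (d : int) (k : nat) : R :=
  d%:~R / n%:R + alpha * (k%:R / n%:R).

(* A coherent subsystem of S is a system S' together with the embedding f of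
   its bundle; it equals S when f identifies the two systems. *)
Definition coh_subsys (F : fieldType) (n' n : nat) (S' : cohsys F n')
    (S : cohsys F n) (f : vbhom S' S) : Prop :=
  [/\ (0 < n')%N, subbundle_emb f &
      [set s *m hom_z f | s in secs S'] `<=` secs S].

Definition cohsys_iso (F : fieldType) (n' n : nat) (S' : cohsys F n')
    (S : cohsys F n) (f : vbhom S' S) : Prop :=
  vbiso f /\ [set s *m hom_z f | s in secs S'] = secs S.

Definition proper_coh_subsys (F : fieldType) (n' n : nat) (S' : cohsys F n')
    (S : cohsys F n) (f : vbhom S' S) : Prop :=
  coh_subsys f /\ ~ cohsys_iso f.

Definition alpha_stable (R : realType) (F : fieldType) (alpha : R) (n : nat)
    (S : cohsys F n) : Prop :=
  forall (d : int) (k : nat), has_type S d k ->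
  forall (n' : nat) (d' : int) (k' : nat) (S' : cohsys F n') (f : vbhom S' S),
    has_type S' d' k' -> proper_coh_subsys f ->
    slope alpha n' d' k' < slope alpha n d k.

(* The points of G(alpha; n, d, k): isomorphism classes of alpha-stable
   coherent systems of type (n, d, k). *)
Definition Gmoduli (F : fieldType) (R : realType) (alpha : R) (n : nat)
    (d : int) (k : nat) : set (set (cohsys F n)) :=
  [set c : set (cohsys F n) | exists S : cohsys F n,
     [/\ has_type S d k, alpha_stable alpha S &
         c = [set S' : cohsys F n | exists f : vbhom S' S, cohsys_iso f]]].

Arguments Gmoduli F {R} alpha n d k.

(* Main.v *)
Require Import Defs.
From HB Require Import structures.
From mathcomp Require Import all_boot all_order all_algebra.
From mathcomp Require Import boolp classical_sets reals.
From mathcomp Require Import perm zify ring lra.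

Set Implicit Arguments.
Unset Strict Implicit.
Unset Printing Implicit Defensive.
Import Order.TTheory GRing.Theory Num.Theory.
Local Open Scope ring_scope.
Local Open Scope classical_set_scope.

(** Write [b = a + l], so that [d = (n - k) b + m] with [0 <= m < n - k]: [b] is
    the integral part of [d / (n - k)], and the bound on [alpha] becomes
    [alpha k < n b - d] ([bound_eq]).  A subsystem [(E', V)] with the same
    sections, of rank [r < n], satisfies the slope inequality if and only if
    [alpha k < n mu(E / E') - d] ([slope_ltP]).  Both halves of the result thus
    compare the slope of [E / E'] with [b].

    Necessity ([stable_bound]).  It is enough to find a nonzero map from [E] to
    [O(b)] that kills [V]: its kernel is a subbundle of rank [n - 1] containing
    [V], and the quotient is a line bundle of degree at most [b]
    ([kernel_subbundle]).  By Riemann-Roch such maps exist when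
    [n (b + 1) - d > k (b + 1)] and [b >= -1] ([exists_hom_killing]), since each
    section in a basis of [V] imposes [b + 1] linear conditions; the first
    inequality is [m < n - k].  The second one follows from [d >= 0]
    ([stable_degree_ge0]): the subsystem [(E, 0)] forces [alpha > 0], while for
    [d < 0] there is a nonzero map from [E] to the negative bundle
    [O(floor (d / n))], which kills [V] for free and gives [alpha < 0].
    Riemann-Roch itself is obtained by counting: for a polynomial matrix [g]
    with determinant [c z^D], the vectors in the image of [g] form a subspace of
    codimension at most [D] ([lattice_codim]).

    Sufficiency ([full_subsystem_slope_lt]).  A subsystem [(E', V')] with
    [dim V' = k] contains all of [V], so [E'] contains the image of [O^k] and
    [E / E'] is a quotient of [G].  All the summands of [G] have degree at least
    [b], hence so does the slope of [E / E'] ([subbundle_degree_le]).  When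
    [E'] has rank [n], the embedding is an isomorphism and the subsystem is not
    proper. *)

(** * Functions on the two charts *)

HB.instance Definition _ (F : fieldType) :=
  GRing.RMorphism.copy (@in_z F) (@tofrac {poly F}).

HB.instance Definition _ (F : fieldType) :=
  GRing.RMorphism.copy (@zconst F) (@tofrac {poly F} \o polyC).

HB.instance Definition _ (F : fieldType) :=
  GRing.RMorphism.copy (@in_w F)
    (horner_eval (zvar F)^-1 \o map_poly (@zconst F)).

Lemma in_z_inj (F : fieldType) : injective (@in_z F).
Proof. by move=> p q /eqP; rewrite /in_z tofrac_eq => /eqP. Qed.

Lemma in_z_eq0 (F : fieldType) (p : {poly F}) : (in_z p == 0) = (p == 0).
Proof. by rewrite -(inj_eq (@in_z_inj F)) rmorph0. Qed.

Lemma zconst_eq0 (F : fieldType) (c : F) : (zconst c == 0) = (c == 0).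
Proof. by rewrite [LHS]in_z_eq0 polyC_eq0. Qed.

Lemma in_zC (F : fieldType) (c : F) : in_z c%:P = zconst c.
Proof. by []. Qed.

Lemma in_zX (F : fieldType) : in_z ('X : {poly F}) = zvar F.
Proof. by []. Qed.

Lemma in_zMX (F : fieldType) (p : {poly F}) (N : nat) :
  in_z (p * 'X^N) = in_z p * zvar F ^+ N.
Proof. by rewrite rmorphM rmorphXn. Qed.

Lemma in_wC (F : fieldType) (c : F) : in_w c%:P = zconst c.
Proof. by rewrite /in_w map_polyC hornerC. Qed.

Lemma in_wX (F : fieldType) : in_w ('X : {poly F}) = (zvar F)^-1.
Proof. by rewrite /in_w map_polyX hornerX. Qed.

Lemma in_z_sum (F : fieldType) (p : {poly F}) (n : nat) :
  (size p <= n)%N -> in_z p = \sum_(i < n) zconst p`_i * zvar F ^+ i.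
Proof.
move=> hn; rewrite -[p in LHS](coefK p) poly_def.
rewrite (big_ord_widen n (fun i => p`_i *: 'X^i)) // big_mkcond rmorph_sum.
apply: eq_bigr => i _; case: ltnP => [_|h].
  by rewrite -mul_polyC rmorphM rmorphXn.
by rewrite nth_default // !rmorph0 mul0r.
Qed.

Lemma in_w_sum (F : fieldType) (p : {poly F}) (n : nat) :
  (size p <= n)%N -> in_w p = \sum_(i < n) zconst p`_i * (zvar F)^-1 ^+ i.
Proof.
move=> hn; rewrite -[p in LHS](coefK p) poly_def.
rewrite (big_ord_widen n (fun i => p`_i *: 'X^i)) // big_mkcond rmorph_sum.
apply: eq_bigr => i _; case: ltnP => [_|h].
  by rewrite -mul_polyC rmorphM rmorphXn /= in_wC in_wX.
by rewrite nth_default // !rmorph0 mul0r.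
Qed.

(** Functions on the two charts are exchanged by [z^N p(1/z)], at the price of a
    denominator [z^N]. *)
Definition rev_poly (F : fieldType) (N : nat) (p : {poly F}) : {poly F} :=
  \poly_(i < N.+1) p`_(N - i).

Lemma rev_polyK (F : fieldType) (N : nat) (p : {poly F}) :
  (size p <= N.+1)%N -> rev_poly N (rev_poly N p) = p.
Proof.
move=> hp; apply/polyP => i; rewrite coef_poly.
case: ltnP => [hi|hi]; last by rewrite nth_default // (leq_trans hp).
by rewrite coef_poly ltnS leq_subr subKn.
Qed.

Lemma in_w_rev (F : fieldType) (N : nat) (p : {poly F}) :
  (size p <= N.+1)%N -> in_w (rev_poly N p) = in_z p / zvar F ^+ N.
Proof.
move=> hp; rewrite (@in_w_sum _ _ N.+1) ?size_poly // (in_z_sum hp) mulr_suml.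
rewrite (reindex_inj rev_ord_inj) /=; apply: eq_bigr => i _.
have hi : (i <= N)%N by rewrite -ltnS ltn_ord.
rewrite coef_poly ltnS subSS leq_subr subKn // -mulrA; congr (_ * _).
have z0 := zvar_neq0 F.
apply: (mulIf (expf_neq0 N z0)); rewrite mulfVK ?expf_neq0 //.
by rewrite -{3}(subnK hi) exprD mulrA exprVn mulVf ?expf_neq0 // mul1r.
Qed.

Lemma in_w_to_z (F : fieldType) (p : {poly F}) (N : nat) : (size p <= N.+1)%N ->
  exists2 q : {poly F}, (size q <= N.+1)%N & in_w p = in_z q / zvar F ^+ N.
Proof.
move=> hp; exists (rev_poly N p); first exact: size_poly.
by rewrite -in_w_rev ?size_poly // rev_polyK.
Qed.

(** The only sections of [O(b)] are the polynomials of degree at most [b]; here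
    [e] is [- b]. All the comparisons of degrees below come down to this. *)
Lemma size_in_z_eq_in_w (F : fieldType) (p q : {poly F}) (e : int) :
  p != 0 -> in_z p * zvar F ^ e = in_w q -> (size p)%:Z + e <= 1.
Proof.
move=> p0; set N := size q.
have [r hr ->] := in_w_to_z (leqnSn (size q)); rewrite -/N in hr *.
have zN := expf_neq0 N (zvar_neq0 F).
have sM (u : {poly F}) M : u != 0 -> size (u * 'X^M) = (size u + M)%N.
  by move=> u0; rewrite size_Mmonic ?monicXn // size_polyXn addnS.
case: e => e; last first.
  rewrite NegzE -exprnN => h.
  have ze := expf_neq0 e.+1 (zvar_neq0 F).
  have : in_z (p * 'X^N) = in_z (r * 'X^(e.+1)).
    by rewrite !in_zMX; apply/eqP; rewrite -(eqr_div _ _ ze zN) h.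
  move=> /in_z_inj E; have := congr1 (fun u : {poly F} => size u) E.
  have r0 : r != 0.
    by apply: contraNneq p0 => r0; move/eqP: E; rewrite r0 mul0r mulf_eq0 
         (negPf (expf_neq0 N (negbT (polyX_eq0 F)))) orbF.
  by rewrite !sM //; lia.
move=> h; have : in_z (p * 'X^(e + N)) = in_z r.
  by rewrite in_zMX exprD mulrA h mulfVK.
by move=> /in_z_inj E; move: hr; rewrite -E sM //; lia.
Qed.

Lemma in_z_eq_zexp (F : fieldType) (p q : {poly F}) (N : nat) :
  p * q = 'X^N -> exists (c : F) (m : nat), c != 0 /\ p = c%:P * 'X^m.
Proof.
elim: N p q => [|N IH] p q h.
  have : p \is a GRing.unit by apply/unitrPr; exists q.
  rewrite poly_unitE => /andP[/size_poly1P[c c0 ->] _].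
  by exists c, 0%N; rewrite expr0 mulr1.
have : root (p * q) 0 by rewrite h exprS /root hornerM hornerX mul0r.
rewrite rootM => /orP[/factor_theorem[r E]|/factor_theorem[r E]];
  rewrite polyC0 subr0 in E.
- have : r * q = 'X^N.
    by apply: (mulIf (negbT (polyX_eq0 F))); rewrite -exprSr -h E mulrAC.
  move=> /IH[c [m [c0 E']]]; exists c, m.+1; split=> //.
  by rewrite E E' exprSr mulrA.
- apply: (IH _ r); apply: (mulIf (negbT (polyX_eq0 F))).
  by rewrite -exprSr -h E mulrA.
Qed.

Lemma laurent_unit_monomial (F : fieldType) (x y : funfield F) :
  laurent x -> laurent y -> x * y = 1 ->
  exists (c : F) (e : int), c != 0 /\ x = zconst c * zvar F ^ e.
Proof.
move=> [p [N ->]] [q [M ->]] h.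
have zN := expf_neq0 N (zvar_neq0 F); have zM := expf_neq0 M (zvar_neq0 F).
have : in_z (p * q) = in_z 'X^(N + M).
  rewrite rmorphM rmorphXn /= in_zX exprD.
  by move: h; rewrite mulf_div => /divr1_eq.
move=> /in_z_inj/in_z_eq_zexp[c [m [c0 ->]]].
exists c, (m%:Z - N%:Z); split=> //.
by rewrite rmorphM rmorphXn /= in_zX in_zC expfzDr ?zvar_neq0 // mulrA -invr_expz.
Qed.

Lemma laurentD (F : fieldType) (x y : funfield F) :
  laurent x -> laurent y -> laurent (x + y).
Proof.
move=> [p [N ->]] [q [M ->]]; exists (p * 'X^M + q * 'X^N), (N + M)%N.
have zN := expf_neq0 N (zvar_neq0 F); have zM := expf_neq0 M (zvar_neq0 F).
rewrite (addf_div (in_z p) (in_z q) zN zM) -exprD -!in_zMX.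
by congr (_ / _); exact: (esym (rmorphD (@in_z F) _ _)).
Qed.

Lemma laurentM (F : fieldType) (x y : funfield F) :
  laurent x -> laurent y -> laurent (x * y).
Proof.
move=> [p [N ->]] [q [M ->]]; exists (p * q), (N + M)%N.
by rewrite rmorphM mulf_div exprD.
Qed.

Lemma laurent_z (F : fieldType) (p : {poly F}) : laurent (in_z p).
Proof. by exists p, 0%N; rewrite expr0 divr1. Qed.

Lemma laurent_w (F : fieldType) (p : {poly F}) : laurent (in_w p).
Proof. by have [q _ ->] := in_w_to_z (leqnSn (size p)); exists q, (size p). Qed.

Definition laurent_mx (F : fieldType) (p q : nat) (A : 'M[funfield F]_(p, q)) :=
  forall i j, laurent (A i j).

Lemma laurent_mulmx (F : fieldType) (p q r : nat) (A : 'M[funfield F]_(p, q))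
    (B : 'M[funfield F]_(q, r)) :
  laurent_mx A -> laurent_mx B -> laurent_mx (A *m B).
Proof.
move=> hA hB i j; rewrite mxE; elim/big_ind: _ => [|x y|k _].
- exact: laurent0.
- exact: laurentD.
- exact: laurentM.
Qed.

Lemma laurent_map_z (F : fieldType) (p q : nat) (A : 'M[{poly F}]_(p, q)) :
  laurent_mx (map_mx (@in_z F) A).
Proof. by move=> i j; rewrite mxE; apply: laurent_z. Qed.

Lemma laurent_map_w (F : fieldType) (p q : nat) (A : 'M[{poly F}]_(p, q)) :
  laurent_mx (map_mx (@in_w F) A).
Proof. by move=> i j; rewrite mxE; apply: laurent_w. Qed.

(** The exponent can be taken large, which keeps the degrees that occur in the
    dimension count nonnegative. *)
Lemma laurent_mx_common (F : fieldType) (p q : nat)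
    (A : 'M[funfield F]_(p, q)) (N0 : nat) :
  laurent_mx A -> exists (B : 'M[{poly F}]_(p, q)) (N : nat),
    (N0 <= N)%N /\ zvar F ^+ N *: A = map_mx (@in_z F) B.
Proof.
move=> /(_ _ _)/cid hA.
pose P i j := projT1 (hA i j).
pose D i j := projT1 (cid (projT2 (hA i j))).
have PD i j : A i j = in_z (P i j) / zvar F ^+ D i j.
  exact: projT2 (cid (projT2 (hA i j))).
pose N := (N0 + \sum_i \sum_j D i j)%N.
have DN i j : (D i j <= N)%N.
  rewrite /N (bigD1 i) //= (bigD1 j) //=; lia.
exists (\matrix_(i, j) (P i j * 'X^(N - D i j))), N; split; first exact: leq_addr.
apply/matrixP => i j; rewrite !mxE PD rmorphM rmorphXn /= in_zX.
rewrite -{1}(subnK (DN i j)) exprD mulrC -mulrA; congr (_ * _).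
by rewrite mulrCA mulVf ?mulr1 // expf_neq0 ?zvar_neq0.
Qed.

(** * Matrices of polynomials *)

(** Euclidean algorithm: subtracting multiples of the top entry replaces the
    others by their remainders, and a nonzero remainder is swapped to the top,
    where the size has dropped. *)
Lemma unimodular_reduce (F : fieldType) (n : nat) (v : 'cV[{poly F}]_(1 + n)) :
  exists (P : 'M[{poly F}]_(1 + n)) (g : 'M[{poly F}]_1),
    P \in unitmx /\ P *m v = col_mx g 0.
Proof.
have swap (w : 'cV[{poly F}]_(1 + n)) i :
    (tperm_mx ord0 i *m w) ord0 0 = w i 0 /\
    @tperm_mx {poly F} (1 + n) ord0 i \in unitmx.
  by rewrite -xrowE !mxE tpermL unitmx_perm.
have main s : forall w : 'cV[{poly F}]_(1 + n), w ord0 0 != 0 ->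
    (size (w ord0 0%R) <= s)%N ->
    exists (P : 'M[{poly F}]_(1 + n)) (g : 'M[{poly F}]_1),
      P \in unitmx /\ P *m w = col_mx g 0.
  elim: s => [|s IH] w w0 hs.
    by move: w0; rewrite -size_poly_gt0; case: (size _) hs.
  pose x := w ord0 0; pose q : 'cV[{poly F}]_n := \col_i (- (dsubmx w i 0 %/ x)).
  pose P0 : 'M[{poly F}]_(1 + n) := block_mx 1%:M 0 q 1%:M.
  have P0u : P0 \in unitmx by rewrite unitmxE det_lblock !det1 mulr1 unitr1.
  have E : P0 *m w = col_mx (usubmx w) (\col_i (dsubmx w i 0 %% x)).
    rewrite -{1}(vsubmxK w) mul_block_col mul1mx mul0mx addr0 mul1mx.
    congr col_mx; apply/colP => i; rewrite !mxE big_ord1 !mxE.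
    have -> : lshift n (0 : 'I_1) = ord0 by apply: val_inj.
    rewrite mulNr addrC; apply/eqP; rewrite subr_eq addrC; apply/eqP.
    exact: divp_eq.
  have [h|] := boolP [forall i, dsubmx w i 0 %% x == 0].
    exists P0, (usubmx w); split=> //; rewrite E; congr col_mx.
    by apply/colP => i; rewrite !mxE; have /forallP/(_ i)/eqP := h; rewrite mxE.
  rewrite negb_forall => /existsP[i hi].
  have [E1 u1] := swap (P0 *m w) (rshift 1 i).
  have E2 : (P0 *m w) (rshift 1 i) 0 = dsubmx w i 0 %% x.
    by rewrite E col_mxEd mxE.
  have [||P [g [Pu Pg]]] := IH (tperm_mx ord0 (rshift 1 i) *m (P0 *m w)).
  - by rewrite E1 E2.
  - by rewrite E1 E2 -ltnS (leq_trans _ hs) // ltn_modp.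
  - exists (P *m tperm_mx ord0 (rshift 1 i) *m P0), g.
    by rewrite !unitmx_mul Pu u1 P0u -!mulmxA Pg.
have [->|/cV0Pn[i hi]] := eqVneq v 0.
  by exists 1%:M, 0; rewrite unitmx1 mulmx0 col_mx0.
have [E1 u1] := swap v i.
have [|P [g [Pu Pg]]] := main _ (tperm_mx ord0 i *m v) _ (leqnn _).
  by rewrite E1.
exists (P *m tperm_mx ord0 i), g.
by rewrite unitmx_mul Pu u1 -mulmxA Pg.
Qed.

(** The image of [g] has codimension at most [D] in the polynomial vectors, seen
    on the span of the rows of [B]. When [D > 0] the matrix [g(0)] is singular.
    In a constant frame whose first vector is in its kernel, the first row of
    [g] is divisible by [z]; dividing it by [z] lowers [D] by one and enlarges
    the image by one dimension. *)
Lemma lattice_codim (F : fieldType) (n D N : nat) (g : 'M[{poly F}]_n) (c : F)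
    (B : 'M[{poly F}]_(N, n)) :
  c != 0 -> \det g = c%:P * 'X^D ->
  exists (N' : nat) (C : 'M[F]_(N', N)) (U : 'M[{poly F}]_(N', n)),
    [/\ row_free C, (N <= N' + D)%N & map_mx polyC C *m B = U *m g].
Proof.
elim: D c g => [|D IH] c g c0 hg.
  have gu : g \in unitmx.
    by rewrite unitmxE hg expr0 mulr1 poly_unitE size_polyC c0 coefC eqxx unitfE.
  exists N, 1%:M, (B *m invmx g); split; rewrite ?addn0 //.
    by rewrite row_free_unit unitmx1.
  by rewrite map_scalar_mx mul1mx -mulmxA mulVmx // mulmx1.
case: n g B hg IH => [|n] g B hg IH.
  move/(congr1 (fun p => p.[0])): hg; rewrite det_mx00 hornerM hornerXn expr0n.
  by rewrite mulr0 hornerC => /eqP; rewrite oner_eq0.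
pose g0 := map_mx (horner_eval 0) g.
have g0s : \det g0 = 0.
  by rewrite det_map_mx hg rmorphM rmorphXn /= !horner_evalE hornerX expr0n mulr0.
have /rowV0Pn[v vk v0] : kermx g0 != 0.
  rewrite kermx_eq0 row_free_unit unitmxE g0s unitr0 //.
move/sub_kermxP: vk => vk.
(* The first row of the constant frame [Q] is proportional to [v]. *)
pose Q : 'M[F]_n.+1 := row_ebase v.
have Qu : Q \in unitmx by apply: row_ebase_unit.
have [a [a0 Qv]] : exists a : F, a != 0 /\ v = a *: row 0 Q.
  have := mulmx_ebase v; rewrite rank_rV v0 => E.
  exists (col_ebase v 0 0); split.
    have := col_ebase_unit v; rewrite unitmxE (mx11_scalar (col_ebase v)) det_scalar1.
    by rewrite unitfE mxE mulr1n.
  rewrite -[LHS]E {1}(mx11_scalar (col_ebase v)) -mulmxA mul_scalar_mx.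
  congr (_ *: _); apply/rowP => j; rewrite !mxE (bigD1 0) //= !mxE /= mul1r.
  rewrite big1 ?addr0 // => i i0.
  by rewrite mxE; case: i i0 => [[|i] hi] //= _; rewrite mul0r.
pose Qg := map_mx polyC Q *m g.
have Qg0 j : 'X %| Qg 0 j.
  rewrite -['X]subr0 -polyC0 dvdp_XsubCl /root; apply/eqP.
  have : (v *m g0) 0 j = 0 by rewrite vk mxE.
  rewrite Qv -scalemxAl mxE => /eqP; rewrite mulf_eq0 (negPf a0) /= => /eqP h0.
  apply: etrans h0; rewrite !mxE horner_sum; apply: eq_bigr => i _.
  by rewrite !mxE hornerM hornerC horner_evalE.
pose G' := \matrix_(i, j) (if i == 0 then Qg i j %/ 'X else Qg i j).
pose dX : 'rV[{poly F}]_n.+1 := \row_i (if i == 0 then 'X else 1).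
have E : Qg = diag_mx dX *m G'.
  apply/matrixP => i j; rewrite mul_diag_mx [RHS]mxE [dX 0 i]mxE [G' i j]mxE.
  by case: eqP => [->|_]; [rewrite mulrC divpK | rewrite mul1r].
have dG' : \det G' = (\det Q * c)%:P * 'X^D.
  have dd : \det (diag_mx dX) = 'X.
    rewrite det_diag (bigD1 0) //= mxE eqxx big1 ?mulr1 // => i i0.
    by rewrite mxE (negPf i0).
  apply: (mulfI (negbT (polyX_eq0 F))).
  rewrite -{1}dd -det_mulmx -E /Qg det_mulmx hg det_map_mx polyCM exprS.
  ring.
have [|N' [C [U [Cf hN CB]]]] := IH _ G' _ dG'.
  by rewrite mulf_neq0 // -unitfE -unitmxE.
(* A vector [u *m G'] is in the image of [g] if the first entry of [u] vanishes
   at 0, which is one linear condition. *)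
pose K := kermx (map_mx (horner_eval 0) (col 0 U)).
exists (\rank K), (row_base K *m C).
pose U2 := map_mx polyC (row_base K) *m U.
have U20 i : 'X %| U2 i 0.
  rewrite -['X]subr0 -polyC0 dvdp_XsubCl /root; apply/eqP.
  have : row_base K *m map_mx (horner_eval 0) (col 0 U) = 0.
    by apply/sub_kermxP; rewrite eq_row_base.
  move=> /matrixP/(_ i 0); rewrite !mxE => h0; apply: etrans h0.
  rewrite horner_sum; apply: eq_bigr => k _.
  by rewrite !mxE hornerM hornerC horner_evalE.
pose U3 := \matrix_(i, j) (if j == 0 then U2 i j %/ 'X else U2 i j).
have E3 : U2 = U3 *m diag_mx dX.
  apply/matrixP => i j; rewrite mul_mx_diag [RHS]mxE [dX 0 j]mxE [U3 i j]mxE.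
  by case: eqP => [->|_]; [rewrite divpK | rewrite mulr1].
exists (U3 *m map_mx polyC Q); split.
- by rewrite /row_free mxrankMfree //; apply: row_base_free.
- rewrite /K mxrank_ker; have := rank_leq_col (map_mx (horner_eval 0) (col 0 U)).
  by lia.
- by rewrite map_mxM -mulmxA CB mulmxA -/U2 E3 -!mulmxA -E.
Qed.

(** * Maps to line bundles *)

(** The rows of [B] are the vectors with one entry [z^i], [i < K], and zeros
    elsewhere. *)
Lemma size_family_free (F : fieldType) (K n : nat) :
  exists B : 'M[{poly F}]_(K * n, n),
    (forall v : 'rV[F]_(K * n), map_mx polyC v *m B = 0 -> v = 0) /\
    (forall (v : 'rV[F]_(K * n)) j, (size ((map_mx polyC v *m B) 0%R j) <= K)%N).
Proof.
pose B : 'M[{poly F}]_(K * n, n) :=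
  \matrix_(s, j) \sum_(i < K) (mxvec_index i j == s)%:R *: 'X^i.
have E (v : 'rV[F]_(K * n)) j :
    (map_mx polyC v *m B) 0 j = \sum_(i < K) v 0 (mxvec_index i j) *: 'X^i.
  rewrite mxE; under eq_bigr do rewrite !mxE mulr_sumr.
  rewrite exchange_big; apply: eq_bigr => i _.
  rewrite (bigD1 (mxvec_index i j)) //= eqxx big1 ?addr0 => [|s hs].
    by rewrite scale1r mul_polyC.
  by rewrite eq_sym (negPf hs) scale0r mulr0.
exists B; split=> [v hv|v j].
  apply/rowP => s; rewrite mxE; case/mxvec_indexP: s => i j.
  have := E v j; rewrite hv mxE => /(congr1 (fun p : {poly F} => p`_i)).
  rewrite coef0 coef_sum (bigD1 i) //= big1 ?addr0 => [|i' hi'].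
    by rewrite coefZ coefXn eqxx mulr1 => <-.
  by rewrite coefZ coefXn eq_sym val_eqE (negPf hi') mulr0.
rewrite E; apply: (leq_trans (size_sum _ _ _)); apply/bigmax_leqP => i _.
by apply: (leq_trans (size_scale_leq _ _)); rewrite size_polyXn.
Qed.

(** Riemann-Roch as a dimension count. With [h = h' / z^N] the inverse of the
    transition matrix, [phiz] defines a map to [O(b)] if and only if the entries
    of [h' *m phiz] have size at most [K = N + b + 1]. Among the [K n]
    coefficients of such vectors, being in the image of [h'] costs
    [D = n N + d] conditions, so that [n (b + 1) - d] dimensions are left. The
    value of the map on a section is a polynomial of degree at most [b], so
    killing it takes at most [c] further conditions. Taking [c = 0] is allowed
    when [b] is negative. *)
Lemma exists_hom_killing (F : fieldType) (n k c : nat) (d b : int)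
    (E : vbundle F n) (B : 'M[{poly F}]_(k, n)) :
  (0 < n)%N -> has_degree E d -> (forall i, H0 E (row i B)) ->
  b < c%:Z -> k%:Z * c%:Z < n%:Z * (b + 1) - d ->
  exists phiz phiw : 'cV[{poly F}]_n,
    [/\ phiz != 0, B *m phiz = 0 &
        zvar F ^ (- b) *: map_mx (@in_z F) phiz = E *m map_mx (@in_w F) phiw].
Proof.
move=> n0 [c0 c00 dE] BE bc hcount.
have z0 := zvar_neq0 F.
have [_ [h [hL Eh]]] := transP E.
have [h' [N [hN hh']]] := laurent_mx_common (`|b| + `|d|)%N hL.
have dh : \det h = (zconst c0)^-1 * zvar F ^ d.
  have := congr1 determinant Eh; rewrite det_mulmx det1 dE => e1.
  have zc0 : zconst c0 != 0 by rewrite zconst_eq0.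
  have e2 := mulf_neq0 zc0 (expfz_neq0 (- d) z0).
  have -> : \det h = (zconst c0 * zvar F ^ (- d))^-1.
    by apply: (mulfI e2); rewrite e1 mulfV.
  by rewrite invfM invr_expz opprK.
have [D hD] : exists D : nat, D%:Z = n%:Z * N%:Z + d.
  exists (absz (n%:Z * N%:Z + d)); rewrite gez0_abs //.
  have : (N <= n * N)%N by rewrite leq_pmull.
  by lia.
have dh' : \det h' = (c0^-1)%:P * 'X^D.
  apply: in_z_inj; rewrite in_zMX -det_map_mx -hh' detZ dh in_zC fmorphV.
  by rewrite mulrCA; congr (_ * _); rewrite -exprM !exprnP -expfzDr // hD mulnC.
have [K hK] : exists K : nat, K%:Z = N%:Z + b + 1.
  exists (absz (N%:Z + b + 1)); rewrite gez0_abs //; lia.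
have [B0 [B0free B0size]] := size_family_free F K n.
have dh'T : \det h'^T = (c0^-1)%:P * 'X^D by rewrite det_tr.
have [|N' [C [U [Cf hN' CU]]]] := lattice_codim B0 _ dh'T.
  by rewrite invr_eq0.
have hkc : (k * c < N')%N.
  have : n%:Z * K%:Z <= N'%:Z + D%:Z by move: hN'; lia.
  by rewrite hK hD; lia.
(* Row [s] lists the coefficients of the values on the sections in [B]. *)
pose cond := \matrix_(s < N') mxvec (\matrix_(i < k, e < c) ((U *m B^T) s i)`_e).
have /rowV0Pn[v /sub_kermxP vc v0] : kermx cond != 0.
  rewrite kermx_eq0; apply: contraTN hkc => /eqP <-.
  by rewrite -leqNgt rank_leq_col.
pose psi := map_mx polyC v *m U.
have psi_h : psi *m h'^T = map_mx polyC (v *m C) *m B0.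
  by rewrite /psi -mulmxA -CU mulmxA map_mxM.
have psi0 : psi != 0.
  apply: contraNneq v0 => psi0; move: psi_h; rewrite psi0 mul0mx => /esym/B0free.
  by move=> h0; apply/eqP/(row_free_inj Cf); rewrite h0 mul0mx.
have psi_coef i (e : 'I_c) : ((psi *m B^T) 0 i)`_e = 0.
  have : (v *m cond) 0 (mxvec_index i e) = 0 by rewrite vc mxE.
  move=> h0; apply: etrans h0; rewrite /psi -mulmxA !mxE coef_sum.
  apply: eq_bigr => s _; rewrite !mxE coefCM; congr (_ * _).
  by rewrite mxvecE !mxE.
(* For [K = 0] only the zero vector would be available. *)
have K0 : (0 < K)%N.
  rewrite lt0n; apply: contraNneq psi0 => K0.
  have hz : psi *m h'^T = 0.
    apply/rowP => j; rewrite psi_h [RHS]mxE; apply/eqP.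
    by rewrite -size_poly_leq0; apply: (leq_trans (B0size _ j)); rewrite K0.
  have h'u : row_free (map_mx (@in_z F) h'^T).
    rewrite row_free_unit unitmxE det_map_mx dh'T unitfE in_z_eq0.
    by rewrite mulf_neq0 ?polyC_eq0 ?invr_eq0 // expf_neq0 // polyX_eq0.
  have : map_mx (@in_z F) psi = 0.
    by apply/(row_free_inj h'u); rewrite -map_mxM hz mul0mx map_mx0.
  move=> /matrixP hp; apply/eqP/rowP => j; apply/in_z_inj.
  by have := hp 0 j; rewrite !mxE rmorph0.
pose p := h' *m psi^T; pose phiw := map_mx (rev_poly K.-1) p.
have psize i : (size (p i 0%R) <= K.-1.+1)%N.
  have -> : p i 0 = (psi *m h'^T) 0 i.
    by rewrite -[psi]trmxK -trmx_mul [RHS]mxE.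
  by rewrite prednK // psi_h B0size.
have glue : zvar F ^ (- b) *: map_mx (@in_z F) psi^T = E *m map_mx (@in_w F) phiw.
  have -> : map_mx (@in_w F) phiw = zvar F ^ (- b) *: (h *m map_mx (@in_z F) psi^T).
    have -> : zvar F ^ (- b) = (zvar F ^+ K.-1)^-1 * zvar F ^+ N.
      by rewrite exprnN exprnP -expfzDr //; congr (_ ^ _); lia.
    rewrite -scalerA scalemxAl hh' -map_mxM -/p; apply/matrixP => i j.
    rewrite (ord1 j) [LHS]mxE [X in in_w X]mxE [RHS]mxE [map_mx _ p _ _]mxE.
    by rewrite in_w_rev // mulrC.
  by rewrite -scalemxAr mulmxA Eh mul1mx.
exists psi^T, phiw; split=> //.
  by apply: contraNneq psi0 => h0; rewrite -[psi]trmxK h0 trmx0.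
have -> : B *m psi^T = (psi *m B^T)^T by rewrite [RHS]trmx_mul trmxK.
apply/matrixP => i j; rewrite (ord1 j) mxE [RHS]mxE.
set q := (psi *m B^T) 0 i.
have [//|q0] := eqVneq q 0.
have [s1 hs1] := BE i.
have hq : in_z q * zvar F ^ (- b) = in_w ((s1 *m phiw) 0 0).
  have -> : in_w ((s1 *m phiw) 0 0) = (map_mx (@in_w F) (s1 *m phiw)) 0 0.
    by rewrite [RHS]mxE.
  rewrite map_mxM -hs1 -mulmxA -glue -scalemxAr -map_mxM [RHS]mxE mulrC.
  congr (_ * _); rewrite [RHS]mxE; congr in_z.
  have -> : row i B *m psi^T = (psi *m (row i B)^T)^T.
    by rewrite [RHS]trmx_mul trmxK.
  by rewrite [RHS]mxE tr_row colE mulmxA -colE [RHS]mxE.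
have hs := size_in_z_eq_in_w q0 hq.
apply/polyP => e; rewrite coef0; case: (ltnP e c) => he.
  exact: (psi_coef i (Ordinal he)).
rewrite nth_default //; apply: leq_trans he.
by move: hs; move: (size q) => sz hs; lia.
Qed.

(** * The kernel of a map to a line bundle *)

Lemma unitmx_det_const (F : fieldType) (n : nat) (P : 'M[{poly F}]_n) :
  P \in unitmx -> exists2 c : F, c != 0 & \det P = c%:P.
Proof.
rewrite unitmxE poly_unitE => /andP[/size_poly1P[c c0 ->] _].
by exists c.
Qed.

Lemma dsubmx_mul_rsubmx (A : comNzRingType) (m n : nat) (P Q : 'M[A]_(m + n)) :
  P *m Q = 1%:M -> dsubmx P *m rsubmx Q = 1%:M.
Proof.
rewrite -{1}(vsubmxK P) -{1}(hsubmxK Q) mul_col_row (scalar_mx_block m n).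
by case/eq_block_mx.
Qed.

Lemma block_first_column (K : fieldType) (n : nat) (M L : 'M[K]_(1 + n))
    (x y : 'M[K]_1) :
  M *m L = 1%:M -> y 0 0 != 0 -> M *m col_mx y 0 = col_mx x 0 ->
  [/\ dlsubmx M = 0, ulsubmx M *m y = x, ulsubmx M *m ulsubmx L = 1%:M &
      drsubmx M *m drsubmx L = 1%:M].
Proof.
move=> ML y0; rewrite -{1}(submxK M) mul_block_col !mulmx0 !addr0.
case/eq_col_mx => Mx M0.
have dl0 : dlsubmx M = 0.
  move: M0; rewrite (mx11_scalar y) mul_mx_scalar => /eqP.
  by rewrite scaler_eq0 (negPf y0) => /eqP.
move: ML; rewrite -{1}(submxK M) -{1}(submxK L) mulmx_block (scalar_mx_block 1 n).
rewrite dl0 !mul0mx !add0r => /eq_block_mx[E1 _ E3 E4].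
have dl0' : dlsubmx L = 0.
  by rewrite -[LHS]mul1mx -(mulmx1C E4) -mulmxA E3 mulmx0.
by split=> //; rewrite -E1 dl0' mulmx0 addr0.
Qed.

Lemma zexp_neq0 (F : fieldType) (e : int) : zvar F ^ e != 0.
Proof. exact: (expfz_neq0 e (zvar_neq0 F)). Qed.

Lemma zexpB (F : fieldType) (x y : int) :
  zvar F ^ (x - y) = zvar F ^ x * (zvar F ^ y)^-1.
Proof. by rewrite expfzDr ?zvar_neq0 // invr_expz. Qed.

(** A change of frame on each chart puts the map in the form [(g, 0, ..., 0)],
    and makes the transition matrix block triangular. The lower block is the
    transition matrix of the kernel. The upper one, [mu = c1 z^m], is that of
    the line bundle [E / E'], of degree [- m]; the map embeds it into [O(b)] and
    so [- m <= b]. *)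
Lemma kernel_subbundle (F : fieldType) (n : nat) (E : vbundle F (1 + n))
    (d b : int) (phiz phiw : 'cV[{poly F}]_(1 + n)) :
  has_degree E d -> phiz != 0 ->
  zvar F ^ (- b) *: map_mx (@in_z F) phiz = E *m map_mx (@in_w F) phiw ->
  exists (E' : vbundle F n) (f : vbhom E' E) (d' : int),
    [/\ has_degree E' d', d - b <= d', subbundle_emb f,
        forall s : 'rV_(1 + n), s *m phiz = 0 -> exists u, s = u *m hom_z f &
        forall u, H0 E (u *m hom_z f) -> H0 E' u].
Proof.
move=> [c c0 dE] phi0 glue.
have z0 := zvar_neq0 F.
have [EL [h [hL Eh]]] := transP E.
have [Pz [gz [Pzu Pzphi]]] := unimodular_reduce phiz.
have [Pw [gw [Pwu Pwphi]]] := unimodular_reduce phiw.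
have gz0 : gz 0 0 != 0.
  apply: contraNneq phi0 => g0; apply/eqP.
  rewrite -(mulKmx Pzu phiz) Pzphi (mx11_scalar gz) g0.
  by rewrite raddf0 col_mx0 mulmx0.
pose M : 'M[funfield F]_(1 + n) :=
  map_mx (@in_z F) Pz *m E *m map_mx (@in_w F) (invmx Pw).
pose L : 'M[funfield F]_(1 + n) :=
  map_mx (@in_w F) Pw *m h *m map_mx (@in_z F) (invmx Pz).
have ML : laurent_mx M.
  apply: laurent_mulmx; last exact: laurent_map_w.
  by apply: laurent_mulmx => //; apply: laurent_map_z.
have LL : laurent_mx L.
  apply: laurent_mulmx; last exact: laurent_map_z.
  by apply: laurent_mulmx => //; apply: laurent_map_w.
have M_L : M *m L = 1%:M.
  rewrite /M /L -!mulmxA [map_mx _ (invmx Pw) *m _]mulmxA -map_mxM mulVmx //.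
  rewrite map_mx1 mul1mx [E *m _]mulmxA Eh mul1mx -map_mxM mulmxV //.
  by rewrite map_mx1.
have MPw : map_mx (@in_z F) Pz *m E = M *m map_mx (@in_w F) Pw.
  by rewrite /M -[RHS]mulmxA -map_mxM mulVmx // map_mx1 mulmx1.
have Mg : M *m col_mx (map_mx (@in_w F) gw) 0
    = zvar F ^ (- b) *: col_mx (map_mx (@in_z F) gz) 0.
  have -> : col_mx (map_mx (@in_w F) gw) (0 : 'cV_n) = map_mx (@in_w F) (Pw *m phiw).
    by rewrite Pwphi map_col_mx map_mx0.
  rewrite map_mxM mulmxA -MPw -mulmxA -glue -scalemxAr -map_mxM Pzphi.
  by rewrite map_col_mx map_mx0.
rewrite scale_col_mx scaler0 in Mg.
have gw0 : map_mx (@in_w F) gw 0 0 != 0.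
  apply: contraNneq gz0 => g0; move: Mg.
  rewrite (mx11_scalar (map_mx _ gw)) g0 raddf0 col_mx0 mulmx0.
  rewrite -[0]col_mx0 => /eq_col_mx[/matrixP/(_ 0 0) + _].
  rewrite !mxE => /esym/eqP; rewrite mulf_eq0 (negPf (expfz_neq0 _ z0)) /=.
  by rewrite in_z_eq0.
have [dl0 Mgx ulL drL] := block_first_column M_L gw0 Mg.
(* Both [mu] and its inverse are Laurent polynomials. *)
pose mu := ulsubmx M 0 0.
have mul1 : mu * ulsubmx L 0 0 = 1.
  by have /matrixP/(_ 0 0) := ulL; rewrite mxE big_ord1 [RHS]mxE.
have ulP (A : 'M[funfield F]_(1 + n)) : laurent_mx A -> laurent (ulsubmx A 0 0).
  by move=> hA; rewrite !mxE; apply: hA.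
have [c1 [m [c10 mue]]] := laurent_unit_monomial (ulP _ ML) (ulP _ LL) mul1.
have mb : - b - m <= 0.
  have h1 : in_z (gz 0 0) * zvar F ^ (- b - m) = in_w (c1%:P * gw 0 0).
    have /matrixP/(_ 0 0) := Mgx.
    rewrite mxE big_ord1 mue [RHS]mxE [map_mx _ gw _ _]mxE [map_mx _ gz _ _]mxE.
    have algebra (K : fieldType) (c' u g v s : K) : u != 0 ->
        c' * u * g = v * s -> s * (v * u^-1) = c' * g.
      by move=> u0 e; rewrite mulrA [s * v]mulrC -e; field.
    have -> : in_w (c1%:P * gw 0 0) = zconst c1 * in_w (gw 0 0).
      by rewrite rmorphM /= in_wC.
    rewrite zexpB => h1.
    exact: (algebra _ _ _ _ _ _ (zexp_neq0 F m) h1).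
  have := size_in_z_eq_in_w gz0 h1.
  have : (0 < size (gz 0%R 0%R))%N by rewrite size_poly_gt0.
  by clear -b m; lia.
have [pz pz0 dPz] := unitmx_det_const Pzu.
have Pwiu : invmx Pw \in unitmx by rewrite unitmx_inv.
have [pw pw0 dPw] := unitmx_det_const Pwiu.
have ddr : \det (drsubmx M) = zconst (c1^-1 * pz * c * pw) * zvar F ^ (- (d + m)).
  have detM : \det M = mu * \det (drsubmx M).
    by rewrite -{1}(submxK M) dl0 det_ublock det_mx11.
  have mu0 : mu != 0.
    by apply/eqP => mu0; move/eqP: mul1; rewrite mu0 mul0r eq_sym oner_eq0.
  apply: (mulfI mu0); rewrite -detM /M !det_mulmx !det_map_mx dPz dPw dE (mue : mu = _).
  rewrite opprD zexpB.
  have -> : zconst (c1^-1 * pz * c * pw)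
      = (zconst c1)^-1 * zconst pz * zconst c * zconst pw.
    by rewrite !rmorphM fmorphV.
  rewrite /= in_wC in_zC.
  have algebra (K : fieldType) (a0 c0' x u p q : K) : c0' != 0 -> u != 0 ->
      p * (a0 * x) * q = c0' * u * (c0'^-1 * p * a0 * q * (x * u^-1)).
    by move=> ? ?; field; apply/andP.
  by apply: (algebra (funfield F)); [rewrite zconst_eq0 | exact: zexp_neq0].
have drP (A : 'M[funfield F]_(1 + n)) : laurent_mx A -> laurent_mx (drsubmx A).
  by move=> hA i j; rewrite !mxE; apply: hA.
have EP : (forall i j, laurent (drsubmx M i j)) /\
    exists h' : 'M[funfield F]_n,
      (forall i j, laurent (h' i j)) /\ drsubmx M *m h' = 1%:M.
  by split; [exact: drP | exists (drsubmx L); split; [exact: drP | ]].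
pose E' := VBundle EP.
have hom : map_mx (@in_z F) (dsubmx Pz) *m E = E' *m map_mx (@in_w F) (dsubmx Pw).
  rewrite map_dsubmx mul_dsub_mx MPw -{1}(submxK M) -{1}(vsubmxK (map_mx _ Pw)).
  by rewrite mul_block_col col_mxKd dl0 mul0mx add0r map_dsubmx.
exists E', (VBHom hom), (d + m); split=> /=.
- exists (c1^-1 * pz * c * pw) => //.
  by rewrite !mulf_neq0 ?invr_eq0.
- by move: mb; clear -d b m; lia.
- move=> x; split; apply/row_freeP.
  + exists (map_mx (horner_eval x) (rsubmx (invmx Pz))).
    by rewrite -map_mxM dsubmx_mul_rsubmx ?map_mx1 // mulmxV.
  + exists (map_mx (horner_eval x) (rsubmx (invmx Pw))).
    by rewrite -map_mxM dsubmx_mul_rsubmx ?map_mx1 // mulmxV.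
- move=> s sphi; pose w := s *m invmx Pz; exists (rsubmx w).
  have sw : s = w *m Pz by rewrite mulmxKV.
  move: sphi; rewrite sw -mulmxA Pzphi -{1}(hsubmxK w) mul_row_col mulmx0 addr0.
  rewrite (mx11_scalar gz) mul_mx_scalar => /matrixP/(_ 0 0).
  rewrite [LHS]mxE [RHS]mxE => /eqP; rewrite mulf_eq0 (negPf gz0) /= => /eqP w00.
  have w0 : lsubmx w = 0 by rewrite (mx11_scalar (lsubmx w)) w00 raddf0.
  by rewrite -{1}(hsubmxK w) w0 -{1}(vsubmxK Pz) mul_row_col mul0mx add0r.
- move=> u [s1 hs1]; exists (s1 *m rsubmx (invmx Pw)).
  rewrite [RHS]map_mxM -hs1 map_mxM -[_ *m _ *m E]mulmxA hom -!mulmxA.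
  by rewrite -map_mxM dsubmx_mul_rsubmx ?mulmxV // map_mx1 mulmx1.
Qed.

(** * The upper bound on alpha *)

(** The right-hand side is [n - r] times [n mu(E / E') - d]. *)
Lemma slope_ltP (R : realType) (alpha : R) (r n : nat) (d' d : int) (k : nat) :
  (0 < r)%N -> (r < n)%N ->
  (slope alpha r d' k < slope alpha n d k) =
  (alpha * k%:R * (n%:R - r%:R) < r%:R * d%:~R - n%:R * d'%:~R).
Proof.
move=> r0 rn; have n0 : (0 < n)%N by apply: leq_trans rn.
have rR : 0 < r%:R :> R by rewrite ltr0n.
have nR : 0 < n%:R :> R by rewrite ltr0n.
have E x (s : R) (y : int) : s = x%:R -> s != 0 ->
    slope alpha x y k = (y%:~R + alpha * k%:R) / s.
  by move=> -> ?; rewrite /slope mulrDl mulrA.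
rewrite (E r r%:R) ?gt_eqF // (E n n%:R) ?gt_eqF //.
rewrite ltr_pdivrMr // mulrAC ltr_pdivlMr // -subr_gt0 -[RHS]subr_gt0.
by congr (0 < _); ring.
Qed.

Lemma bound_eq (R : realType) (n k t m : nat) (d a l : int) :
  (0 < k)%N -> (k < n)%N -> d = n%:Z * a - t%:Z ->
  k%:Z * a - t%:Z = l * (n%:Z - k%:Z) + m%:Z ->
  d%:~R / (n%:R - k%:R) - (m%:R * n%:R) / (k%:R * (n%:R - k%:R))
  = (n%:R * (a + l)%:~R - d%:~R) / k%:R :> R.
Proof.
move=> k0 kn hd hl.
have kR : k%:R != 0 :> R by rewrite pnatr_eq0 -lt0n.
have nkR : n%:R - k%:R != 0 :> R by rewrite subr_eq0 eqr_nat gtn_eqF.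
have dR : d%:~R = n%:R * a%:~R - t%:R :> R by rewrite hd rmorphB rmorphM.
have mR : m%:R = k%:R * a%:~R - t%:R - l%:~R * (n%:R - k%:R) :> R.
  have := congr1 (fun x : int => x%:~R : R) hl.
  rewrite rmorphB rmorphD !rmorphM rmorphB /= => ->.
  by rewrite addrAC subrr add0r.
rewrite dR mR rmorphD /=; field.
by rewrite kR nkR.
Qed.

Lemma secs_row (F : fieldType) (n k : nat) (V : set 'rV[{poly F}]_n)
    (B : 'M[{poly F}]_(k, n)) (i : 'I_k) :
  V = range (fun c : 'rV[F]_k => map_mx polyC c *m B) -> V (row i B).
Proof.
by move=> ->; exists (delta_mx 0 i) => //; rewrite map_delta_mx -rowE.
Qed.

(** Compare [(E, V)] with its proper subsystem [(E, 0)]. *)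
Lemma stable_alpha_gt0 (R : realType) (F : fieldType) (alpha : R) (n k : nat)
    (d : int) (S : cohsys F n) :
  (0 < n)%N -> (0 < k)%N -> has_type S d k -> alpha_stable alpha S -> 0 < alpha.
Proof.
move=> n0 k0 Sdk st; have [Sd [B [Binj VB]]] := Sdk.
have sub0 : [set (0 : 'rV[{poly F}]_n)] `<=` H0 S.
  by move=> _ ->; exists 0; rewrite !map_mx0 mul0mx.
have lin0 : [set (0 : 'rV[{poly F}]_n)] 0 /\
    forall (c : F) u v, [set (0 : 'rV[{poly F}]_n)] u ->
      [set (0 : 'rV[{poly F}]_n)] v -> [set (0 : 'rV[{poly F}]_n)] (c%:P *: u + v).
  by split=> // c u v -> ->; rewrite scaler0 addr0.
have id_hom : map_mx (@in_z F) 1%:M *m S = S *m map_mx (@in_w F) 1%:M.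
  by rewrite !map_mx1 mul1mx mulmx1.
pose S0 := CohSys sub0 lin0.
pose f : vbhom S0 S := VBHom id_hom.
have t0 : has_type S0 d 0.
  split=> //; exists 0; split; first by move=> u v _; apply/rowP => -[].
  by apply/seteqP; split=> [_ ->|_ [u _ <-]]; [exists 0 | ]; rewrite ?mulmx0.
have proper : proper_coh_subsys f.
  split.
    split=> // [x|_ [_ -> <-]].
      by rewrite /= map_mx1 row_free_unit unitmx1.
    by rewrite mul0mx; case: (secs_subspace S).
  case=> _ e; have := secs_row (Ordinal k0) VB; rewrite -e => -[_ -> /=].
  rewrite mul0mx => /esym B0.
  have e1 : map_mx polyC (delta_mx 0 (Ordinal k0) : 'rV[F]_k) *m B
      = map_mx polyC (0 : 'rV[F]_k) *m B.
    by rewrite map_delta_mx -rowE B0 map_mx0 mul0mx.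
  have /matrixP/(_ 0 (Ordinal k0)) := Binj _ _ e1.
  by rewrite !mxE !eqxx => /eqP; rewrite oner_eq0.
have := st d k Sdk n d 0%N S0 f t0 proper.
rewrite /slope mul0r mulr0 addr0 ltrDl pmulr_lgt0 //.
by rewrite divr_gt0 // ltr0n.
Qed.

(** Apply stability to the kernel of a nonzero map to [O(b)] that kills [V]. *)
Lemma stable_hom_bound (R : realType) (F : fieldType) (alpha : R)
    (n k c : nat) (d b : int) (S : cohsys F n) :
  (2 <= n)%N -> has_type S d k -> alpha_stable alpha S ->
  b < c%:Z -> k%:Z * c%:Z < n%:Z * (b + 1) - d ->
  alpha * k%:R < n%:R * b%:~R - d%:~R.
Proof.
case: n S => [//|n] S n1 Sdk st bc hcount; have [Sd [B [Binj VB]]] := Sdk.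
have BH i : H0 S (row i B) by apply: secs_H0; apply: secs_row VB.
have [phiz [phiw [phi0 Bphi glue]]] :=
  exists_hom_killing (ltn0Sn n) Sd BH bc hcount.
have [E' [f [d' [Ed' dd' emb ker_f H0_f]]]] :=
  @kernel_subbundle F n S d b phiz phiw Sd phi0 glue.
have rowB i : exists u : 'rV_n, row i B = u *m hom_z f.
  by apply: ker_f; rewrite -row_mul Bphi row0.
pose B' := \matrix_(i < k) projT1 (cid (rowB i)).
have BB' : B = B' *m hom_z f.
  apply/row_matrixP => i; rewrite row_mul rowK.
  exact: projT2 (cid (rowB i)).
pose V' := range (fun c : 'rV[F]_k => map_mx polyC c *m B').
have V'H0 : V' `<=` H0 E'.
  move=> _ [u _ <-]; apply: H0_f; rewrite -mulmxA -BB'.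
  by apply: (@secs_H0 _ _ S); rewrite VB; exists u.
have V'lin : V' 0 /\ forall (c : F) u v, V' u -> V' v -> V' (c%:P *: u + v).
  split; first by exists 0; rewrite // map_mx0 mul0mx.
  move=> e _ _ [u _ <-] [v _ <-]; exists (e *: u + v) => //.
  by rewrite map_mxD map_mxZ mulmxDl scalemxAl.
pose S' := CohSys V'H0 V'lin.
have t' : has_type S' d' k.
  split=> //; exists B'; split=> // u v /= e; apply: Binj.
  by rewrite BB' !mulmxA e.
have proper : @proper_coh_subsys F n n.+1 S' S f.
  split.
    split=> //= _ [_ [u _ <-] <-].
    by rewrite -mulmxA -BB' VB; exists u.
  case=> -[g [_ gf _ _]] _.
  have := congr1 (map_mx (horner_eval (0 : F))) gf.
  rewrite map_mxM map_mx1 => /(congr1 (fun A : 'M[F]_n.+1 => \rank A)).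
  rewrite mxrank1 => e; have := mxrankM_maxr (map_mx (horner_eval (0 : F)) (hom_z g))
     (map_mx (horner_eval (0 : F)) (hom_z f)).
  by rewrite e leqNgt ltnS rank_leq_row.
have := st d k Sdk n d' k S' f t' proper.
rewrite slope_ltP // -[n.+1%:R]natr1 addrAC subrr add0r mulr1 => h.
have : (d - b)%:~R <= d'%:~R :> R by rewrite ler_int.
rewrite rmorphB /= => dR; have := ler0n R n; nra.
Qed.

(** If [d < 0], the integral part [b] of [d / n] is negative. Maps to [O(b)] kill
    every section, so that no condition is imposed by [V], and the resulting
    bound [alpha k < n b - d <= 0] contradicts [alpha > 0]. *)
Lemma stable_degree_ge0 (R : realType) (F : fieldType) (alpha : R) (n k : nat)
    (d : int) (S : cohsys F n) :
  (2 <= n)%N -> (0 < k)%N -> has_type S d k -> alpha_stable alpha S -> 0 <= d.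
Proof.
move=> n2 k0 Sdk st; rewrite leNgt; apply/negP => d0.
have n0 : 0 < n%:Z by rewrite ltz_nat ltnW.
have := divz_eq d n; have := modz_ge0 d (lt0r_neq0 n0); have := ltz_pmod d n0.
move: (d %/ n)%Z (d %% n)%Z => b r rn r0 e.
have b0 : b < 0 by nia.
have := @stable_hom_bound R F alpha n k 0 d b S n2 Sdk st b0 _.
have -> : k%:Z * 0%:Z < n%:Z * (b + 1) - d by lia.
move=> /(_ isT) h; have a0 := stable_alpha_gt0 (ltnW n2) k0 Sdk st.
have : n%:R * b%:~R <= d%:~R :> R.
  have -> : n%:R * b%:~R = (n%:Z * b)%:~R :> R by rewrite rmorphM.
  by rewrite ler_int; lia.
have : 0 < alpha * k%:R by rewrite mulr_gt0 // ltr0n.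
lra.
Qed.

Lemma stable_bound (R : realType) (F : fieldType) (alpha : R)
    (n k t m : nat) (d a l : int) (S : cohsys F n) :
  (2 <= n)%N -> (0 < k)%N -> (k < n)%N -> d = n%:Z * a - t%:Z ->
  (m < n - k)%N -> k%:Z * a - t%:Z = l * (n%:Z - k%:Z) + m%:Z ->
  has_type S d k -> alpha_stable alpha S ->
  alpha * k%:R < n%:R * (a + l)%:~R - d%:~R.
Proof.
move=> n2 k0 kn hd hm hl Sdk st.
have d0 := stable_degree_ge0 n2 k0 Sdk st.
have hdm : d = (n%:Z - k%:Z) * (a + l) + m%:Z by lia.
have al0 : 0 <= a + l by nia.
apply: (@stable_hom_bound R F alpha n k (absz (a + l)).+1 d (a + l) S) => //.
  by lia.
have -> : (absz (a + l)).+1%:Z = a + l + 1 by lia.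
rewrite hdm; nia.
Qed.

(** * Subsystems with all the sections *)

(** A maximal minor that is nonzero at one point is a nonzero polynomial. *)
Lemma row_free_in_z (F : fieldType) (r n : nat) (A : 'M[{poly F}]_(r, n)) (x : F) :
  row_free (map_mx (horner_eval x) A) -> row_free (map_mx (@in_z F) A).
Proof.
move=> /row_freeP[B AB]; set u := A *m map_mx polyC B.
have du : \det u != 0.
  have e : map_mx (horner_eval x) (map_mx polyC B) = B.
    by apply/matrixP => i j; rewrite !mxE horner_evalE hornerC.
  apply/eqP => /(congr1 (horner_eval x)); rewrite -det_map_mx map_mxM e AB det1.
  by rewrite rmorph0 => /eqP; rewrite oner_eq0.
have : map_mx (@in_z F) u \in unitmx.
  by rewrite unitmxE det_map_mx unitfE in_z_eq0.
rewrite /u map_mxM => uu; apply/row_freeP.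
exists (map_mx (@in_z F) (map_mx polyC B) *m
        invmx (map_mx (@in_z F) A *m map_mx (@in_z F) (map_mx polyC B))).
by rewrite mulmxA mulmxV.
Qed.

Lemma exists_row_free_rowsub (K : fieldType) (p n s : nat) (A : 'M[K]_(p, n)) :
  \rank A = s -> exists sigma : 'I_s -> 'I_p, row_free (rowsub sigma A).
Proof. by move=> <-; exists (maxrankfun A); apply: maxrowsub_free. Qed.

(** Steinitz exchange: modulo the rows of [A], those of [Y] span a space of
    dimension [s], and [s] of them form a basis of it. *)
Lemma exchange_rows (K : fieldType) (r s p : nat) (A : 'M[K]_(r, r + s))
    (Y : 'M[K]_(p, r + s)) (P : 'M[K]_(r + s, r)) (Q : 'M[K]_(r + s, p)) :
  row_free A -> P *m A + Q *m Y = 1%:M ->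
  exists sigma : 'I_s -> 'I_p, col_mx A (rowsub sigma Y) \in unitmx.
Proof.
move=> Afree AY; pose C := cokermx A.
have AC : A *m C = 0 by apply: mulmx_coker.
have rC : \rank C = s by rewrite mxrank_coker (eqP Afree) addKn.
have rYC : \rank (Y *m C) = s.
  rewrite -[RHS]rC; apply/eqP; rewrite eqn_leq mxrankM_maxr /=.
  have {1}-> : C = Q *m (Y *m C).
    by rewrite -[LHS]mul1mx -AY mulmxDl -!mulmxA AC mulmx0 add0r.
  exact: mxrankM_maxr.
have [sigma sC] := exists_row_free_rowsub rYC.
exists sigma; rewrite -row_free_unit.
apply: inj_row_free => v; rewrite -(hsubmxK v) mul_row_col => e.
have v2 : rsubmx v = 0.
  apply/(row_free_inj sC); rewrite mul0mx.
  have := congr1 (mulmx^~ C) e.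
  by rewrite /= mulmxDl mul0mx -!mulmxA AC mulmx0 add0r mul_rowsub_mx.
rewrite v2 mul0mx addr0 in e.
have v1 : lsubmx v = 0 by apply/(row_free_inj Afree); rewrite e mul0mx.
by rewrite v1 v2 row_mx0.
Qed.

(** The matrix [C] that expresses a basis of the image of [V'] in a basis of [V]
    is square and injective, hence invertible over the constants. *)
Lemma same_dim_secs (F : fieldType) (r n k : nat) (V' : set 'rV[{poly F}]_r)
    (V : set 'rV[{poly F}]_n) (f : 'M[{poly F}]_(r, n)) :
  row_free (map_mx (@in_z F) f) -> has_dim V' k -> has_dim V k ->
  [set s *m f | s in V'] `<=` V -> [set s *m f | s in V'] = V.
Proof.
move=> ffree [B' [B'inj VB']] [B [Binj VB]] sub; apply/seteqP; split=> //.
have finj u : u *m f = 0 -> u = 0 :> 'rV_r.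
  move=> uf; have : map_mx (@in_z F) u = 0.
    by apply/(row_free_inj ffree); rewrite -map_mxM uf mul0mx map_mx0.
  move=> /matrixP hu; apply/rowP => j; apply/in_z_inj.
  by have := hu 0 j; rewrite !mxE rmorph0.
have rowC i : exists c : 'rV[F]_k, row i (B' *m f) = map_mx polyC c *m B.
  have : V (row i (B' *m f)).
    by apply: sub; exists (row i B'); rewrite ?row_mul //; apply: secs_row VB'.
  by rewrite VB => -[c _ <-]; exists c.
pose C := \matrix_(i < k) projT1 (cid (rowC i)).
have CB : map_mx polyC C *m B = B' *m f.
  apply/row_matrixP => i; rewrite row_mul -map_row rowK.
  exact: esym (projT2 (cid (rowC i))).
have Cu : C \in unitmx.
  rewrite -row_free_unit; apply: inj_row_free => v vC.
  have e1 : map_mx polyC v *m B' = map_mx polyC (0 : 'rV[F]_k) *m B'.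
    rewrite map_mx0 mul0mx; apply: finj.
    by rewrite -mulmxA -CB mulmxA -map_mxM vC map_mx0 mul0mx.
  exact: (B'inj _ _ e1).
rewrite VB => _ [c _ <-]; exists (map_mx polyC (c *m invmx C) *m B').
  by rewrite VB'; exists (c *m invmx C).
by rewrite -mulmxA -CB mulmxA -map_mxM mulmxKV.
Qed.

(** Over an algebraically closed field a polynomial without roots is a
    constant. *)
Lemma unitmx_no_root (F : closedFieldType) (n : nat) (A : 'M[{poly F}]_n) :
  (forall x : F, row_free (map_mx (horner_eval x) A)) -> A \in unitmx.
Proof.
move=> h; rewrite unitmxE poly_unitE.
have [/closed_rootP[x rx]|] := boolP (size (\det A) != 1).
  have := h x; rewrite row_free_unit unitmxE det_map_mx unitfE.
  by rewrite /= /horner_eval (rootP rx) eqxx.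
rewrite negbK => s1; rewrite s1 /= unitfE.
by have /size_poly1P[c c0 ->] := s1; rewrite coefC.
Qed.

Lemma emb_same_rank_iso (F : closedFieldType) (r n : nat) (E' : vbundle F r)
    (E : vbundle F n) (f : vbhom E' E) : r = n -> subbundle_emb f -> vbiso f.
Proof.
move=> rn; subst r => emb.
have zu : hom_z f \in unitmx by apply: unitmx_no_root => x; case: (emb x).
have wu : hom_w f \in unitmx by apply: unitmx_no_root => x; case: (emb x).
have hom : map_mx (@in_z F) (invmx (hom_z f)) *m E'
    = E *m map_mx (@in_w F) (invmx (hom_w f)).
  have e := homP f.
  have zz : map_mx (@in_z F) (invmx (hom_z f)) *m map_mx (@in_z F) (hom_z f) = 1%:M.
    by rewrite -map_mxM (mulVmx zu) map_mx1.
  have ww : map_mx (@in_w F) (hom_w f) *m map_mx (@in_w F) (invmx (hom_w f)) = 1%:M.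
    by rewrite -map_mxM (mulmxV wu) map_mx1.
  by rewrite -[trans E in RHS]mul1mx -zz -[_ *m _ *m trans E]mulmxA e -!mulmxA ww mulmx1.
by exists (VBHom hom); split; rewrite /= ?(mulVmx zu) ?(mulmxV zu) ?(mulVmx wu) ?(mulmxV wu).
Qed.

(** In the frames formed by [f] and [y] on the two charts, the transition matrix
    of [E] becomes block triangular with diagonal blocks [E'] and [(+) O(b j)].
    Its determinant does not see [X], whose entries can be any rational
    functions. The frames may degenerate at some points: their determinants then
    embed [det E' (x) O(sum of the b j)] into [det E], and a nonzero map between
    line bundles does not lower the degree. *)
Lemma degree_triangular_le (F : fieldType) (r s : nat) (d' d : int)
    (E' : vbundle F r) (E : vbundle F (r + s)) (f : vbhom E' E)
    (b : 'I_s -> int) (yz yw : 'M[{poly F}]_(s, r + s))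
    (X : 'M[funfield F]_(s, r)) :
  has_degree E' d' -> has_degree E d ->
  map_mx (@in_z F) yz *m E
    = X *m map_mx (@in_w F) (hom_w f) + Osum_trans F b *m map_mx (@in_w F) yw ->
  map_mx (@in_z F) (col_mx (hom_z f) yz) \in unitmx ->
  d' + \sum_j b j <= d.
Proof.
move=> [c' c'0 dE'] [c c0 dE] hy; rewrite unitmxE det_map_mx unitfE in_z_eq0 => p0.
set pz := \det (col_mx (hom_z f) yz) in p0.
pose pw := \det (col_mx (hom_w f) yw).
have E1 : map_mx (@in_z F) (col_mx (hom_z f) yz) *m E
    = block_mx E' 0 X (Osum_trans F b) *m map_mx (@in_w F) (col_mx (hom_w f) yw).
  by rewrite !map_col_mx mul_col_mx mul_block_col mul0mx addr0 homP hy.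
have dO : \det (Osum_trans F b) = zvar F ^ (- \sum_j b j).
  rewrite det_diag -sumrN; under eq_bigr do rewrite mxE.
  elim/big_ind2: _ => [|x u y v -> ->|//]; first by rewrite expr0z.
  by rewrite expfzDr ?zvar_neq0.
have := congr1 determinant E1.
rewrite !det_mulmx det_lblock !det_map_mx -/pz -/pw dE dE' dO => h1.
have := @size_in_z_eq_in_w F pz ((c^-1 * c')%:P * pw) (d' + \sum_j b j - d) p0.
have -> : in_w ((c^-1 * c')%:P * pw) = (zconst c)^-1 * zconst c' * in_w pw.
  by rewrite rmorphM /= in_wC rmorphM fmorphV.
have algebra (K : fieldType) (p q e e' u v w : K) :
    e != 0 -> u != 0 -> v != 0 -> w != 0 ->
    p * (e * w^-1) = e' * u^-1 * v^-1 * q -> p * (u * v * w^-1) = e^-1 * e' * q.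
  move=> e0 u0 v0 w0 h.
  transitivity (p * (e * w^-1) * (u * v * e^-1)); first by field; apply/andP.
  by rewrite h; field; apply/and3P.
have zc0 : zconst c != 0 by rewrite zconst_eq0.
have zexpN (x : int) : zvar F ^ (- x) = (zvar F ^ x)^-1 by rewrite invr_expz.
rewrite !zexpN in h1.
have h2 := algebra _ _ _ _ _ _ _ _ zc0 (zexp_neq0 F d') (zexp_neq0 F (\sum_j b j))
  (zexp_neq0 F d) h1.
rewrite zexpB expfzDr ?zvar_neq0 // => /(_ h2).
have : (0 < size pz)%N by rewrite size_poly_gt0.
by move: (size pz) (\sum_j b j); clear; lia.
Qed.

(** The generators of the summands of [G] are lifted to [E] on each chart. The
    two lifts need not glue, but their difference [D] is killed by [pi], and by
    exactness on the [w]-chart it comes from [i]; it is the class of the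
    extension restricted to the summands. By exactness on the [z]-chart, the
    lifts and the image of [i] together generate [E] there. *)
Lemma lift_splitting (F : fieldType) (p n q : nat) (b : 'I_q -> int)
    (K : vbundle F p) (E : vbundle F n) (G : vbundle F q)
    (i : vbhom K E) (pi : vbhom E G) :
  short_exact i pi -> vbisomorphic G (Osum F b) ->
  exists (yz yw : 'M[{poly F}]_(q, n)) (T : 'M[funfield F]_(q, p))
      (P : 'M[{poly F}]_(n, p)) (Q : 'M[{poly F}]_(n, q)),
    [/\ map_mx (@in_z F) yz *m E
        = T *m map_mx (@in_w F) (hom_w i) + Osum_trans F b *m map_mx (@in_w F) yw &
        P *m hom_z i + Q *m yz = 1%:M].
Proof.
have lift (f : 'M[{poly F}]_(p, n)) (g : 'M[{poly F}]_(n, q)) (u v : 'M[{poly F}]_q) :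
    short_exact_mx f g -> u *m v = 1%:M ->
    exists (y : 'M[{poly F}]_(q, n)) (P : 'M[{poly F}]_(n, p)),
      [/\ y *m g = v & P *m f + g *m u *m y = 1%:M].
  move=> [_ ker surj] uv.
  have [y yg] : exists y : 'M[{poly F}]_(q, n), y *m g = v.
    exists (\matrix_j projT1 (cid (surj (row j v)))); apply/row_matrixP => j.
    by rewrite row_mul rowK; exact: esym (projT2 (cid (surj (row j v)))).
  have kerg (A : 'M[{poly F}]_n) : A *m g = 0 -> exists P, A = P *m f.
    move=> Ag; have h j : exists w, row j A = w *m f.
      by apply/ker; rewrite -row_mul Ag row0.
    exists (\matrix_j projT1 (cid (h j))); apply/row_matrixP => j.
    by rewrite row_mul rowK; exact: projT2 (cid (h j)).
  have [|P hP] := kerg (1%:M - g *m u *m y).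
    by rewrite mulmxBl mul1mx -[_ *m y *m g]mulmxA yg -mulmxA uv mulmx1 subrr.
  by exists y, P; split=> //; rewrite -hP subrK.
move=> [ez ew] [g [g' [uvz _ uvw _]]].
have [yz [Pz [yzg hz]]] := lift _ _ _ _ ez uvz.
have [yw [Pw [ywg hw]]] := lift _ _ _ _ ew uvw.
pose D := map_mx (@in_z F) yz *m E - Osum_trans F b *m map_mx (@in_w F) yw.
have D0 : D *m map_mx (@in_w F) (hom_w pi) = 0.
  rewrite mulmxBl -!mulmxA -map_mxM ywg -homP mulmxA -map_mxM yzg.
  by rewrite (homP g') subrr.
exists yz, yw, (D *m map_mx (@in_w F) Pw), Pz, (hom_z pi *m hom_z g); split=> //.
have -> : D *m map_mx (@in_w F) Pw *m map_mx (@in_w F) (hom_w i) = D.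
  rewrite -mulmxA -map_mxM -[RHS]mulmx1 -(map_mx1 (@in_w F)) -hw map_mxD mulmxDr.
  by rewrite -[hom_w pi *m _ *m yw]mulmxA (map_mxM _ (hom_w pi)) [D *m (_ *m _)]mulmxA
    D0 mul0mx addr0.
by rewrite subrK.
Qed.

Lemma Osum_trans0 (F : fieldType) (p : nat) :
  Osum_trans F (fun _ : 'I_p => 0) = 1%:M.
Proof. by apply/matrixP => x y; rewrite !mxE oppr0 expr0z. Qed.

(** The quotient [E / E'] has rank [s] and is a quotient of [G]. The lifts of [s]
    of the summands of [G] are independent of [E'] over the function field, and
    their degrees add up to at most the degree of [E / E']. *)
Lemma subbundle_degree_le (F : fieldType) (p n r s q : nat)
    (d d' b0 : int) (b : 'I_q -> int) (E' : vbundle F r) (E : vbundle F n) (G : vbundle F q)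
    (i : vbhom (Otriv F p) E) (pi : vbhom E G) (f : vbhom E' E)
    (j : 'M[{poly F}]_(p, r)) :
  n = (r + s)%N ->
  has_degree E' d' -> has_degree E d -> short_exact i pi ->
  vbisomorphic G (Osum F b) -> (forall x, b0 <= b x) ->
  row_free (map_mx (@in_z F) (hom_z f)) -> hom_z i = j *m hom_z f ->
  d' + s%:Z * b0 <= d.
Proof.
move=> ens; subst n => dE' dE ex iso hb ffree ij.
have [yz [yw [T [P [Q [glue span]]]]]] := lift_splitting ex iso.
have iw : map_mx (@in_w F) (hom_w i)
    = map_mx (@in_z F) j *m E' *m map_mx (@in_w F) (hom_w f).
  by rewrite -mulmxA -homP mulmxA -map_mxM -ij homP /= Osum_trans0 mul1mx.
have spanF : map_mx (@in_z F) (P *m j) *m map_mx (@in_z F) (hom_z f)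
    + map_mx (@in_z F) Q *m map_mx (@in_z F) yz = 1%:M.
  by rewrite -!map_mxM -mulmxA -ij -map_mxD span map_mx1.
have [sigma unit_fy] := exchange_rows ffree spanF.
rewrite iw in glue.
have glue' : map_mx (@in_z F) (rowsub sigma yz) *m E
    = rowsub sigma (T *m (map_mx (@in_z F) j *m E')) *m map_mx (@in_w F) (hom_w f)
      + Osum_trans F (b \o sigma) *m map_mx (@in_w F) (rowsub sigma yw).
  have -> : map_mx (@in_z F) (rowsub sigma yz) = rowsub sigma (map_mx (@in_z F) yz).
    by apply/matrixP => x y; rewrite !mxE.
  have -> : Osum_trans F (b \o sigma) *m map_mx (@in_w F) (rowsub sigma yw)
      = rowsub sigma (Osum_trans F b *m map_mx (@in_w F) yw).
    apply/matrixP => x y; rewrite [RHS]mxE /Osum_trans !mul_diag_mx.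
    by rewrite !mxE.
  rewrite !mul_rowsub_mx glue mulmxA.
  move: (T *m _ *m _) (Osum_trans F b *m _) => A B.
  by apply/matrixP => x y; rewrite !mxE.
apply: le_trans (degree_triangular_le dE' dE glue' _); last first.
  rewrite map_col_mx.
  by have -> : map_mx (@in_z F) (rowsub sigma yz) = rowsub sigma (map_mx (@in_z F) yz)
    by apply/matrixP => x y; rewrite !mxE.
have -> : s%:Z * b0 = \sum_(x < s) b0.
  by rewrite sumr_const card_ord -mulr_natl natz.
by rewrite lerD2l; apply: ler_sum => x _; apply: hb.
Qed.

Lemma Otriv_row (F : fieldType) (p : nat) (x : 'I_p) : H0 (Otriv F p) (delta_mx 0 x).
Proof. by exists (delta_mx 0 x); rewrite !map_delta_mx /= Osum_trans0 mulmx1. Qed.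

Lemma full_subsystem_slope_lt (F : closedFieldType) (R : realType) (alpha : R)
    (n k r q : nat) (d d' b0 : int) (b : 'I_q -> int) (S : cohsys F n)
    (G : vbundle F q) (i : vbhom (Otriv F k) S) (pi : vbhom S G)
    (S' : cohsys F r) (f : vbhom S' S) :
  has_type S d k -> short_exact i pi ->
  secs S = [set s *m hom_z i | s in H0 (Otriv F k)] ->
  vbisomorphic G (Osum F b) -> (forall x, b0 <= b x) ->
  alpha * k%:R < n%:R * b0%:~R - d%:~R ->
  has_type S' d' k -> proper_coh_subsys f ->
  slope alpha r d' k < slope alpha n d k.
Proof.
move=> [dS dimS] ex secsS iso hb ha [dS' dimS'] [[r0 emb sub] nproper].
have ffree : row_free (map_mx (@in_z F) (hom_z f)).
  by have [h _] := emb 0; apply: row_free_in_z h.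
have secsE := same_dim_secs ffree dimS' dimS sub.
have rn : (r <= n)%N by move: ffree; rewrite /row_free => /eqP <-; apply: rank_leq_col.
move: rn; rewrite leq_eqVlt => /orP[/eqP rn|rn].
  by case: nproper; split=> //; apply: emb_same_rank_iso.
have rowf x : exists u, row x (hom_z i) = u *m hom_z f.
  have : secs S (row x (hom_z i)).
    by rewrite secsS; exists (delta_mx 0 x); [apply: Otriv_row | rewrite -rowE].
  by rewrite -secsE => -[u _ <-]; exists u.
pose j := \matrix_(x < k) projT1 (cid (rowf x)).
have ij : hom_z i = j *m hom_z f.
  by apply/row_matrixP => x; rewrite row_mul rowK; exact: projT2 (cid (rowf x)).
have ens : n = (r + (n - r))%N by rewrite subnKC // ltnW.
have dd := subbundle_degree_le ens dS' dS ex iso hb ffree ij.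
rewrite slope_ltP //.
have sR : 0 < n%:R - r%:R :> R by rewrite subr_gt0 ltr_nat.
have ddR : d'%:~R + (n%:R - r%:R) * b0%:~R <= d%:~R :> R.
  rewrite -natrB ?(ltnW rn) // -[(n - r)%:R]/((n - r)%:Z%:~R) -rmorphM -rmorphD.
  by rewrite ler_int.
have := ler0n R n; nra.
Qed.

Theorem proposition4p2 (F : closedFieldType) (R : realType)
    (n k : nat) (d : int) (alpha : R) (a l : int) (t m : nat)
    (hn : (2 <= n)%N) (hk0 : (0 < k)%N) (hkn : (k < n)%N)
    (ht : (t < n)%N) (hd : d = n%:Z * a - t%:Z)
    (hm : (m < n - k)%N)
    (hl : k%:Z * a - t%:Z = l * (n%:Z - k%:Z) + m%:Z) :
  let bound : R := d%:~R / (n%:R - k%:R)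
                   - (m%:R * n%:R) / (k%:R * (n%:R - k%:R)) in
  (Gmoduli F alpha n d k !=set0 -> alpha < bound) /\
  (forall (S : cohsys F n) (G : vbundle F (n - k))
      (i : vbhom (Otriv F k) S) (q : vbhom S G),
    has_type S d k ->
    short_exact i q ->
    secs S = [set s *m hom_z i | s in H0 (Otriv F k)] ->
    vbisomorphic S (Osum2 F n (n - t) a (a - 1)) ->
    vbisomorphic G (Osum2 F (n - k) m (a + l + 1) (a + l)) ->
    alpha < bound ->
    forall (r : nat) (d' : int) (S' : cohsys F r) (f : vbhom S' S),
      has_type S' d' k -> proper_coh_subsys f ->
      slope alpha r d' k < slope alpha n d k).
Proof.
rewrite /= (bound_eq R hk0 hkn hd hl).
have kR : 0 < k%:R :> R by rewrite ltr0n.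
rewrite ltr_pdivlMr //; split.
  move=> [_ [S [Sdk stable _]]].
  exact: stable_bound hn hk0 hkn hd hm hl Sdk stable.
move=> S G i q Sdk ex secsS _ splitG ha r d' S' f.
apply: (full_subsystem_slope_lt Sdk ex secsS splitG _ ha) => x.
by case: ifP; rewrite // lerDl.
Qed.
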